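(* Consider the semidefinite program $$p^*=\min_X \ \operatorname{Tr}(C^TX)\quad\text{s.t.}\quad \operatorname{Tr}(A_i^TX)=b_i\ (i=1,\dots,M),\quad X\succeq 0,$$ with $N\times N$ real symmetric data $C,A_1,\dots,A_M$, $b\in\mathbb{R}^M$, satisfying: $\operatorname{Tr}(A_i^TA_j)=0$ for all $i\neq j$, $\operatorname{Tr}(A_i^TC)=0$ for all $i$, $\|C\|_F=\|A_i\|_F=1$ for all $i$; there is a feasible $X\succ0$; and $p^*>-\infty$. For $t>0$ let $X_t$ be the minimizer of $\operatorname{Tr}(C^TX)-\frac1t\log\det X$ subject to $\operatorname{Tr}(A_i^TX)=b_i$, $X\succ0$, and let $\gamma(t)\in\mathbb{R}^M$ be the associated Lagrange multipliers, i.e. $X_t^{-1}=t\big(C-\sum_{i}\gamma_i(t)A_i\big)$. Let $K$ be either $DD_N$ (with $0<\Phi\le \frac{2}{N+1}$) or $SDD_N$ (with $0<\Phi\le 1$). Fix $t_0>0$ and $0<\epsilon^*\le N/t_0$, put $t^*=N/\epsilon^*$, and let $\Theta=\max_{t\in[t_0,t^*]}\sum_{i=1}^M\gamma_i(t)^2$. Run the following idealized (exact-centering) algorithm: $X_0=X_{t_0}$; for $k\ge1$, with $U_{k-1}$ the Cholesky factor of $X_{k-1}$ ($X_{k-1}=U_{k-1}^TU_{k-1}$), let $X_k^{\mathrm{dec}}$ be an optimizer of $$\min_{X,Y}\operatorname{Tr}(C^TX)\ \text{s.t.}\ \operatorname{Tr}(A_i^TX)=b_i\ (i=1,\dots,M),\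 X=U_{k-1}^TYU_{k-1},\ Y\in K,$$ and let $X_k$ be the maximizer of $\log\det X$ over $\{X\succ0:\operatorname{Tr}(A_i^TX)=b_i\ \forall i,\ \operatorname{Tr}(C^TX)=\operatorname{Tr}(C^TX_k^{\mathrm{dec}})\}$. Then, with $$\chi=\frac{N\sqrt{1+\Theta}}{N\sqrt{1+\Theta}-\sqrt{\Phi}}>1,\qquad \kappa=\left\lceil\frac{\log(N/\epsilon^* )-\log t_0}{\log\chi}\right\rceil,$$ the algorithm reaches $\epsilon^*$-optimality within $\kappa$ iterations: $\operatorname{Tr}(C^TX_\kappa)-p^*\le\epsilon^*$.
   Context: A symmetric matrix $X$ is diagonally dominant ($X\in DD_N$) if $X(i,i)\ge\sum_{j\ne i}|X(i,j)|$ for all $i$; it is scaled diagonally dominant ($X\in SDD_N$) if $X=DYD$ for some positive diagonal $D$ and some $Y\in DD_N$. The Cholesky factor $U$ of $X\succ0$ is the upper-triangular matrix with $X=U^TU$. The curve $t\mapsto X_t$ is the central path of the SDP. *)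

(* Defs.v *)
From HB Require Import structures.
From mathcomp Require Import all_boot all_order all_algebra.
From mathcomp Require Import all_classical all_reals exp.
Set Implicit Arguments. Unset Strict Implicit. Unset Printing Implicit Defensive.
Import Order.TTheory GRing.Theory Num.Theory.
Local Open Scope ring_scope.
Local Open Scope classical_set_scope.

Section Defs.
Variables (R : realType) (N : nat).

Definition symmx (X : 'M[R]_N) : Prop := X^T = X.

Definition psd (X : 'M[R]_N) : Prop :=
  symmx X /\ forall x : 'cV[R]_N, 0 <= (x^T *m X *m x) 0 0.

Definition pd (X : 'M[R]_N) : Prop :=
  symmx X /\ forall x : 'cV[R]_N, x != 0 -> 0 < (x^T *m X *m x) 0 0.

Definition trip (A X : 'M[R]_N) : R := \tr (A^T *m X).

Definition frob (A : 'M[R]_N) : R := Num.sqrt (trip A A).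

Definition DD (X : 'M[R]_N) : Prop :=
  symmx X /\ forall i : 'I_N, \sum_(j < N | j != i) `|X i j| <= X i i.

Definition SDD (X : 'M[R]_N) : Prop :=
  exists d : 'rV[R]_N, (forall i, 0 < d 0 i) /\
    exists Y, DD Y /\ X = diag_mx d *m Y *m diag_mx d.

Definition cholesky_factor (X U : 'M[R]_N) : Prop :=
  (forall i j : 'I_N, (j < i)%N -> U i j = 0) /\
  (forall i : 'I_N, 0 < U i i) /\ X = U^T *m U.

Variables (M : nat) (A : 'I_M -> 'M[R]_N) (b : 'I_M -> R).

Definition feasible (X : 'M[R]_N) : Prop := forall i, trip (A i) X = b i.

End Defs.

(* Main.v *)
Require Import Defs.
From HB Require Import structures.
From mathcomp Require Import all_boot all_order all_algebra.
From mathcomp Require Import all_classical all_reals exp.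
From mathcomp Require Import ring lra.
Import Order.TTheory GRing.Theory Num.Theory.
Local Open Scope ring_scope.
Local Open Scope classical_set_scope.

(* Each iterate is a point [Xc a] of the central path with [t0 <= a]: the first
   order condition for the log-det maximizer puts [(Xs k)^-1] in the span of [C]
   and the [A i], and strict monotonicity of [X |-> - X^-1], tested on feasible
   differences, both identifies the iterate with [Xc a] and orders the
   parameters.  Weak duality then bounds the gap by [N / a].  Since [C] is
   orthogonal to the constraints, [Xs k - s C] is feasible; in the coordinates
   [U^T Y U] it is [Y = 1 - s U^-T C U^-1], which lies in the cone as long as
   [s |U^-T C U^-1| < sqrt Phi], and
   [|U^-T C U^-1| <= |(Xs k)^-1| <= a sqrt (1 + Theta)].  Hence one iteration
   lowers the objective by at least [sqrt Phi / (a sqrt (1 + Theta))], that is by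
   a fraction [1 - 1 / chi] of [N / a], hence of the gap. *)

(** * The Frobenius norm: Cauchy-Schwarz, submultiplicativity, small perturbations of the
    identity *)

Section FrobeniusNorm.
Set Implicit Arguments. Unset Strict Implicit. Unset Printing Implicit Defensive.
Context {R : realFieldType}.

(** Working with the square avoids roots; rectangular shapes are allowed so that column vectors are
    covered too. *)
Definition sqfrob {m n} (A : 'M[R]_(m, n)) : R := \tr (A^T *m A).

Lemma mxtrace_trmulE m n (A B : 'M[R]_(m, n)) :
  \tr (A^T *m B) = \sum_i \sum_j A i j * B i j.
Proof.
rewrite exchange_big; apply: eq_bigr => j _; rewrite mxE.
by apply: eq_bigr => i _; rewrite mxE.
Qed.

Lemma sqfrobE m n (A : 'M[R]_(m, n)) : sqfrob A = \sum_i \sum_j A i j ^+ 2.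
Proof.
rewrite /sqfrob mxtrace_trmulE.
by do 2 (apply: eq_bigr => ? _); rewrite expr2.
Qed.

Lemma sqfrob_ge0 m n (A : 'M[R]_(m, n)) : 0 <= sqfrob A.
Proof. by rewrite sqfrobE; do 2 (apply: sumr_ge0 => ? _); exact: sqr_ge0. Qed.

Lemma sqfrob_eq0 m n (A : 'M[R]_(m, n)) : sqfrob A = 0 -> A = 0.
Proof.
rewrite sqfrobE => A0; apply/matrixP => i j; rewrite mxE.
have /psumr_eq0P/(_ A0 i isT) Ai0 : forall i, true -> 0 <= \sum_j A i j ^+ 2.
  by move=> k _; apply: sumr_ge0 => l _; exact: sqr_ge0.
apply/eqP; rewrite -sqrf_eq0; apply/eqP.
by move: j isT; apply: psumr_eq0P => // k _; exact: sqr_ge0.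
Qed.

Lemma sqfrob_tr m n (A : 'M[R]_(m, n)) : sqfrob A^T = sqfrob A.
Proof. by rewrite /sqfrob trmxK mxtrace_mulC. Qed.

Lemma sqfrobZ m n c (A : 'M[R]_(m, n)) : sqfrob (c *: A) = c ^+ 2 * sqfrob A.
Proof.
rewrite !sqfrobE mulr_sumr; apply: eq_bigr => i _; rewrite mulr_sumr.
by apply: eq_bigr => j _; rewrite mxE exprMn.
Qed.

Lemma sqfrob_abs m n (A : 'M[R]_(m, n)) : sqfrob (map_mx Num.norm A) = sqfrob A.
Proof.
rewrite !sqfrobE; do 2 (apply: eq_bigr => ? _).
by rewrite mxE real_normK ?num_real.
Qed.

Lemma ler_sqfrob m n (A B : 'M[R]_(m, n)) :
  (forall i j, `|A i j| <= `|B i j|) -> sqfrob A <= sqfrob B.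
Proof.
move=> AB; rewrite !sqfrobE; do 2 (apply: ler_sum => ? _).
by rewrite -real_normK ?num_real // -[leRHS]real_normK ?num_real // lerXn2r ?nnegrE.
Qed.

(** Cauchy-Schwarz through Lagrange's identity: the double sum of [(a i * c j - a j * c i) ^+ 2] is
    twice the difference of the two sides. *)
Lemma sqr_sum_mul_le (I : finType) (P : pred I) (a c : I -> R) :
  (\sum_(i | P i) a i * c i) ^+ 2 <=
  (\sum_(i | P i) a i ^+ 2) * (\sum_(i | P i) c i ^+ 2).
Proof.
have : 0 <= \sum_(i | P i) \sum_(j | P j) (a i * c j - a j * c i) ^+ 2.
  by do 2 (apply: sumr_ge0 => ? _); exact: sqr_ge0.
have -> : \sum_(i | P i) \sum_(j | P j) (a i * c j - a j * c i) ^+ 2 =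
   (\sum_(i | P i) a i ^+ 2) * (\sum_(i | P i) c i ^+ 2)
   + (\sum_(i | P i) c i ^+ 2) * (\sum_(i | P i) a i ^+ 2)
   - ((\sum_(i | P i) a i * c i) * (\sum_(i | P i) a i * c i)) *+ 2.
  rewrite !big_distrlr /= -sumrMnl -big_split /= -sumrB.
  apply: eq_bigr => i _; rewrite -sumrMnl -big_split /= -sumrB.
  by apply: eq_bigr => j _; ring.
rewrite expr2; lra.
Qed.

Lemma sqfrobM m n p (A : 'M[R]_(m, n)) (B : 'M[R]_(n, p)) :
  sqfrob (A *m B) <= sqfrob A * sqfrob B.
Proof.
rewrite -(sqfrob_tr B) !sqfrobE big_distrlr /=.
apply: ler_sum => i _; apply: ler_sum => k _; rewrite mxE.
apply: le_trans (sqr_sum_mul_le _ _ _) _; apply: ler_wpM2l.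
  by apply: sumr_ge0 => ? _; exact: sqr_ge0.
by apply: ler_sum => j _; rewrite mxE.
Qed.

Lemma mxtrace_trmul_le m n (A B : 'M[R]_(m, n)) :
  \tr (A^T *m B) *+ 2 <= sqfrob A + sqfrob B.
Proof.
rewrite mxtrace_trmulE !sqfrobE -sumrMnl -big_split /=.
apply: ler_sum => i _; rewrite -sumrMnl -big_split /=.
apply: ler_sum => j _; have := sqr_ge0 (A i j - B i j); nra.
Qed.

(* [|E^T C E|^2 = tr (G C G C)] with [G = E E^T], and [C G = (G C)^T]. *)
Lemma sqfrob_congr_le n (E C : 'M[R]_n) : C^T = C ->
  sqfrob (E^T *m C *m E) <= sqfrob (E *m E^T) * sqfrob C.
Proof.
move=> symC; set G := E *m E^T.
have symG : G^T = G by rewrite /G trmx_mul trmxK.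
have -> : sqfrob (E^T *m C *m E) = \tr ((C *m G)^T *m (G *m C)).
  rewrite (trmx_mul C G) symG /sqfrob !trmx_mul trmxK symC.
  by rewrite /G !mulmxA mxtrace_mulC !mulmxA.
have := mxtrace_trmul_le (C *m G) (G *m C).
rewrite -[sqfrob (C *m G)]sqfrob_tr (trmx_mul C G) symC symG.
have := sqfrobM G C; lra.
Qed.

(** Since [2 x^T (- W x) <= |x|^2 + |W x|^2] and [|W x|^2 <= |W|^2 |x|^2 < |x|^2], the perturbation
    cannot cancel [|x|^2]. *)
Lemma quad_form_1D_gt0 n (W : 'M[R]_n) (x : 'cV[R]_n) :
  sqfrob W < 1 -> x != 0 -> 0 < (x^T *m (1%:M + W) *m x) 0 0.
Proof.
move=> W1 x0; have {x0} x_gt0 : 0 < sqfrob x.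
  rewrite lt0r sqfrob_ge0 andbT; apply: contra x0 => /eqP.
  by move/sqfrob_eq0 => ->.
rewrite -trace_mx11 mulmxDr mulmxDl mulmx1 linearD /= -/(sqfrob x).
have := mxtrace_trmul_le x (- (W *m x)).
rewrite -scaleN1r sqfrobZ -scalemxAr linearZ /= mulmxA.
have := sqfrobM W x; nra.
Qed.

End FrobeniusNorm.

(** * Balls around the identity contained in the cones [DD] and [SDD] *)

Section Cones.
Set Implicit Arguments. Unset Strict Implicit. Unset Printing Implicit Defensive.
Context {R : realType}.

(** By symmetry each off-diagonal entry of row [i] is counted twice in [sqfrob V]. This improves the
    Cauchy-Schwarz constant [N] to [(N + 1) / 2], the source of the bound on [Phi] for [DD]. *)
Lemma row_abs_sum_le N (V : 'M[R]_N) i : (1 < N)%N -> V^T = V ->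
  (\sum_j `|V i j|) ^+ 2 <= N.+1%:R / 2 * sqfrob V.
Proof.
move=> N1 symV; pose Q := \sum_(j | j != i) V i j ^+ 2.
pose S := \sum_(j | j != i) `|V i j|; pose m : R := N%:R - 1.
have m_gt0 : 0 < m by rewrite subr_gt0 ltr1n.
have SQ : S ^+ 2 <= m * Q.
  have := sqr_sum_mul_le (fun j => j != i) (fun=> 1) (fun j => `|V i j|).
  rewrite -[X in X <= _]/((\sum_(j | j != i) 1 * `|V i j|) ^+ 2).
  under eq_bigr do rewrite mul1r.
  under [X in X * _]eq_bigr do rewrite expr1n.
  under [X in _ * X]eq_bigr do rewrite real_normK ?num_real //.
  rewrite sumr_const (_ : #|_| = N.-1).
    by rewrite -subn1 natrB // ltnW.
  by rewrite cardC1 card_ord.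
have VQ : V i i ^+ 2 + Q + Q <= sqfrob V.
  rewrite sqfrobE (bigD1 i) //= (_ : \sum_j V i j ^+ 2 = V i i ^+ 2 + Q);
    last by rewrite (bigD1 i).
  rewrite lerD2l; apply: ler_sum => j ji; rewrite (bigD1 i) //= -{1}symV mxE.
  by rewrite lerDl; apply: sumr_ge0 => ? _; exact: sqr_ge0.
rewrite (bigD1 i) //= -/S -natr1 (_ : N%:R = m + 1); last by rewrite /m; ring.
have -> : (`|V i i| + S) ^+ 2 = V i i ^+ 2 + S ^+ 2 + 2 * (`|V i i| * S).
  by rewrite -[V i i ^+ 2]real_normK ?num_real //; ring.
apply: le_trans (_ : (m + 1 + 1) / 2 * (V i i ^+ 2 + Q + Q) <= _); last first.
  by apply: ler_wpM2l VQ; lra.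
(* what remains is [2 v S <= 2 Q + m v^2 / 2], AM-GM since [S^2 <= m Q] *)
suff : 0 <= m * (2 * Q + m / 2 * V i i ^+ 2 - 2 * (`|V i i| * S)).
  by rewrite pmulr_rge0 //; lra.
have := sqr_ge0 (2 * S - m * `|V i i|).
have -> : (2 * S - m * `|V i i|) ^+ 2 =
  4 * S ^+ 2 + m ^+ 2 * V i i ^+ 2 - 4 * m * (`|V i i| * S).
  by rewrite -[V i i ^+ 2]real_normK ?num_real //; ring.
nra.
Qed.

Lemma DD_1B N (V : 'M[R]_N) : (1 < N)%N -> V^T = V ->
  sqfrob V <= 2 / N.+1%:R -> DD (1%:M - V).
Proof.
move=> N1 symV V2; split=> [|i]; first by rewrite /symmx linearB /= trmx1 symV.
(* A row sum of at most 1 gives dominance: the off-diagonal part is at most [1 - |V i i|], hence at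
   most [1 - V i i]. *)
have : \sum_j `|V i j| <= 1.
  rewrite -(@expr_le1 _ 2) ?sumr_ge0 //; apply: le_trans (row_abs_sum_le _ _ _) _ => //.
  by rewrite mulrC -ler_pdivlMr ?divr_gt0 ?ltr0n // mul1r invf_div.
rewrite (bigD1 i) //= !mxE eqxx.
have := ler_norm (V i i).
rewrite (_ : \sum_(j < N | j != i) `|(1%:M - V) i j| = \sum_(j < N | j != i) `|V i j|).
  rewrite [1%:R]/=; lra.
by apply: eq_bigr => j ji; rewrite !mxE eq_sym (negbTE ji) sub0r normrN.
Qed.

(** The hypotheses give [|x|^2 <= |B x|^2 <= |B|^2 |x|^2] with [|B|^2 < 1]. *)
Lemma sqfrob_fix_eq0 n (B : 'M[R]_n) (x : 'cV[R]_n) :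
  sqfrob B < 1 -> (forall i j, `|x i j| <= `|(B *m x) i j|) -> x = 0.
Proof.
move=> B1 xB; apply: sqfrob_eq0; have := ler_sqfrob xB.
have := sqfrobM B x; have := sqfrob_ge0 x; nra.
Qed.

Lemma unitmx_inj n (Z : 'M[R]_n) :
  (forall x : 'cV[R]_n, Z *m x = 0 -> x = 0) -> Z \in unitmx.
Proof.
move=> inj; rewrite -unitmx_tr -row_free_unit -kermx_eq0; apply/eqP/row_matrixP => i.
rewrite row0; apply: trmx_inj; rewrite trmx0; apply: inj.
by apply: trmx_inj; rewrite trmx_mul trmxK -row_mul mulmx_ker row0 trmx0.
Qed.

(* [d = (1 - |V|)^-1 1] satisfies [d = 1 + |V| d], hence [d >= 1], and
   rescaling by [d] turns this equation into diagonal dominance. *)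
Lemma SDD_1B N (V : 'M[R]_N) : V^T = V -> sqfrob V < 1 -> SDD (1%:M - V).
Proof.
move=> symV; rewrite -sqfrob_abs; set B := map_mx _ _ => B1.
have Bge0 i j : 0 <= B i j by rewrite mxE.
have uB : 1%:M - B \in unitmx.
  apply: unitmx_inj => x; rewrite mulmxBl mul1mx => /subr0_eq xB.
  by apply: (sqfrob_fix_eq0 B1) => i j; rewrite -xB.
have [d dE] : exists d : 'cV[R]_N, d = const_mx 1 + B *m d.
  exists (invmx (1%:M - B) *m const_mx 1); set d := _ *m _.
  by apply/eqP; rewrite -subr_eq -{1}[d]mul1mx -mulmxBl mulKVmx.
have d_ge0 i : 0 <= d i 0.
  (* [x] is the negative part of [d]. As [B] and the constant vector are nonnegative, [d = 1 + B d]
     yields [0 <= x <= B x] entrywise, so [x] vanishes. *)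
  pose x : 'cV[R]_N := \col_k Num.max (- d k 0) 0.
  suff /colP/(_ i) : x = 0.
    have : - d i 0 <= x i 0 by rewrite mxE le_max lexx.
    by move=> /[swap] ->; rewrite mxE oppr_le0.
  apply: (sqfrob_fix_eq0 B1) => k j; rewrite {j}ord1.
  have x0 l : 0 <= x l 0 by rewrite mxE le_max lexx orbT.
  have Bx0 : 0 <= (B *m x) k 0.
    by rewrite mxE; apply: sumr_ge0 => l _; rewrite mulr_ge0.
  rewrite !ger0_norm // [x k 0]mxE ge_max Bx0 andbT dE !mxE opprD -sumrN.
  rewrite -[leRHS]add0r; apply: lerD; first by rewrite lerN10.
  apply: ler_sum => l _; rewrite -mulrN; apply: ler_wpM2l => //.
  by rewrite mxE le_max lexx.
have d_gt0 i : 0 < d i 0.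
  rewrite dE !mxE; apply: ltr_pwDl => //; apply: sumr_ge0 => j _.
  by rewrite mulr_ge0.
have d_neq0 i : d i 0 != 0 by rewrite gt_eqF.
exists (\row_i (d i 0)^-1); split=> [i|]; first by rewrite mxE invr_gt0.
exists (\matrix_(i, j) (d i 0 * (1%:M - V) i j * d j 0)); split; last first.
  apply/matrixP => i j; rewrite mul_mx_diag mul_diag_mx !mxE.
  by field; rewrite !d_neq0.
split=> [|i].
  apply/matrixP => i j; rewrite !mxE eq_sym -{1}symV mxE; ring.
(* The equation for [d] evaluates the off-diagonal row sum; it remains to compare it with the
   diagonal entry [d_i^2 (1 - V i i)], using [V i i <= B i i]. *)
rewrite (_ : \sum_(j < N | _) _ = d i 0 * (d i 0 - 1 - B i i * d i 0)).
  rewrite !mxE eqxx -!mulrA; apply: ler_wpM2l => //.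
  have := ler_norm (V i i); have := d_gt0 i; rewrite [1%:R]/=; nra.
have -> : d i 0 - 1 - B i i * d i 0 = \sum_(j < N | j != i) B i j * d j 0.
  rewrite {1}dE mxE [const_mx _ _ _]mxE mxE (bigD1 i) //=; ring.
rewrite mulr_sumr; apply: eq_bigr => j ji.
rewrite !mxE eq_sym (negbTE ji) sub0r !normrM normrN.
by rewrite !(ger0_norm (d_ge0 _)) mulrA.
Qed.

End Cones.

(** * Monotonicity of inversion and first-order behaviour of the determinant *)

Section PositiveDefinite.
Set Implicit Arguments. Unset Strict Implicit. Unset Printing Implicit Defensive.
Context {R : realType} {N : nat}.
Implicit Types P Q H U Z : 'M[R]_N.

(** [\det (1 + s M)] is the reversed characteristic polynomial of [- M]: its constant and linear
    coefficients are 1 and [\tr M], and for [s <= 1] the other terms are bounded by [s^2] times the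
    absolute values of the remaining coefficients. This replaces differentiating the determinant. *)
Lemma det_1DZ_ge (M : 'M[R]_N) : (0 < N)%N ->
  exists K, forall s, 0 < s <= 1 ->
    1 + s * \tr M - s ^+ 2 * K <= \det (1%:M + s *: M).
Proof.
case: N M => // n M _; pose c := (char_poly (- M)).
exists (\sum_(i < n) `|c`_i|) => s /andP[s0 s1].
have s_neq0 : s != 0 by rewrite gt_eqF.
have -> : \det (1%:M + s *: M) = s ^+ n.+1 * c.[s^-1].
  rewrite /c /char_poly -[RHS]/(_ * horner_eval s^-1 _) -det_map_mx -detZ.
  congr (\det _); apply/matrixP => i j; rewrite !mxE /= /horner_eval.
  by rewrite hornerD hornerN hornerC hornerMn hornerX mulrDr opprK mulrnAr
    mulfV.
set tau := \tr M; rewrite horner_coef size_char_poly 2!big_ord_recr /= 2!mulrDr.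
rewrite [s ^+ n.+1 * \sum_(i < n) _]mulr_sumr.
have -> : c`_n.+1 = 1.
  by have /monicP := char_poly_monic (- M); rewrite lead_coefE size_char_poly.
have -> : c`_n = tau by rewrite (@char_poly_trace _ n.+1) // linearN opprK.
have -> : s ^+ n.+1 * (1 * s^-1 ^+ n.+1) = 1.
  by rewrite mul1r -exprMn mulfV // expr1n.
have -> : s ^+ n.+1 * (tau * s^-1 ^+ n) = s * tau.
  rewrite mulrCA exprS -mulrA -exprMn mulfV // expr1n; ring.
suff : - (s ^+ 2 * \sum_(i < n) `|c`_i|) <=
    \sum_(i < n) s ^+ n.+1 * (c`_i * s^-1 ^+ i) by lra.
rewrite mulr_sumr -sumrN; apply: ler_sum => i _.
have -> : s ^+ n.+1 * (c`_i * s^-1 ^+ i) = s ^+ 2 * (s ^+ (n - i.+1) * c`_i).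
  have -> : n.+1 = (2 + (n - i.+1) + i)%N
    by rewrite addnAC -[(2 + i)%N]/i.+2 addSn subnKC.
  have E : s ^+ i * s^-1 ^+ i = 1 by rewrite -exprMn mulfV // expr1n.
  rewrite !exprD -[RHS]mulr1 -E {E}.
  by move: (s ^+ i) (s^-1 ^+ i) (s ^+ (n - _)) => *; ring.
rewrite -mulrN; apply: ler_wpM2l; first by rewrite exprn_ge0 // ltW.
have p1 : s ^+ (n - i.+1) <= 1 by apply: exprn_ile1 => //; exact: ltW.
have p0 : 0 <= s ^+ (n - i.+1) by rewrite exprn_ge0 // ltW.
have : `|s ^+ (n - i.+1) * c`_i| <= `|c`_i| by rewrite normrM ger0_norm // ler_piMl.
by rewrite ler_norml => /andP[].
Qed.

Lemma pd_unitmx Q : pd Q -> Q \in unitmx.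
Proof.
move=> [_ Q0]; apply: unitmx_inj => x Qx.
apply/eqP; apply/negP => /negP /Q0.
by rewrite -mulmxA Qx mulmx0 mxE ltxx.
Qed.

Lemma mxtrace_congrE Q Z : \tr (Z^T *m Q *m Z) =
  \sum_j ((col j Z)^T *m Q *m col j Z) 0 0.
Proof.
apply: eq_bigr => j _; rewrite tr_col -row_mul [LHS]mxE [RHS]mxE.
by apply: eq_bigr => k _; rewrite [row _ _ _ _]mxE [col _ _ _ _]mxE.
Qed.

Lemma psd_trace_congr_ge0 Q Z : psd Q -> 0 <= \tr (Z^T *m Q *m Z).
Proof. by move=> [_ Q0]; rewrite mxtrace_congrE; apply: sumr_ge0 => j _. Qed.

Lemma pd_psd Q : pd Q -> psd Q.
Proof.
move=> [symQ Q0]; split=> // x; have [->|/Q0/ltW//] := eqVneq x 0.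
by rewrite mulmx0 mxE.
Qed.

Lemma pd_trace_congr_le0 Q Z : pd Q -> \tr (Z^T *m Q *m Z) <= 0 -> Z = 0.
Proof.
move=> pdQ tr0; have [_ Q0] := pd_psd pdQ.
have /psumr_eq0P Z0 : forall j, true -> 0 <= ((col j Z)^T *m Q *m col j Z) 0 0 by [].
apply/matrixP => i j; have /Z0/(_ j isT) : \sum_j ((col j Z)^T *m Q *m col j Z) 0 0 = 0.
  by apply/eqP; rewrite eq_le -mxtrace_congrE tr0 psd_trace_congr_ge0 //; exact: pd_psd.
have [/colP/(_ i)|/pdQ.2] := eqVneq (col j Z) 0; first by rewrite !mxE.
by move=> /[swap] ->; rewrite ltxx.
Qed.

Lemma invmx_gram U : U \in unitmx ->
  invmx (U^T *m U) = invmx U *m (invmx U)^T.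
Proof.
move=> uU; have uP : U^T *m U \in unitmx by rewrite unitmx_mul unitmx_tr uU.
apply: (can_inj (mulKmx uP)); rewrite mulmxV // !mulmxA mulmxK //.
by rewrite trmx_inv mulmxV ?unitmx_tr.
Qed.

(* [tr ((P^-1 - Q^-1) (P - Q)) = - tr (Z^T Q Z)] with [Z = Q^-1 (P - Q) U^-1] *)
Lemma trace_inv_sub_ge0 P Q U : U \in unitmx -> P = U^T *m U -> pd Q ->
  0 <= \tr ((invmx P - invmx Q) *m (P - Q)) -> P = Q.
Proof.
move=> uU PE pdQ tr_ge0; have uQ := pd_unitmx pdQ; have [symQ _] := pdQ.
have uP : P \in unitmx by rewrite PE unitmx_mul unitmx_tr uU.
have symP : P^T = P by rewrite PE trmx_mul trmxK.
pose Z := invmx Q *m (P - Q) *m invmx U.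
suff Z0 : Z = 0.
  apply/subr0_eq; have -> : P - Q = Q *m Z *m U.
    by rewrite /Z !mulmxA mulmxV // mul1mx mulmxKV.
  by rewrite Z0 mulmx0 mul0mx.
apply: (pd_trace_congr_le0 pdQ); rewrite -oppr_ge0; congr (0 <= _): tr_ge0.
have -> : invmx P - invmx Q = - (invmx P *m (P - Q) *m invmx Q).
  by rewrite mulmxBr mulVmx // mulmxBl mul1mx mulmxK // opprB.
rewrite mulNmx linearN /=; congr (- _).
have symD : (P - Q)^T = P - Q by rewrite linearB /= symP symQ.
rewrite /Z !trmx_mul symD [(invmx Q)^T]trmx_inv symQ.
rewrite {1}PE invmx_gram // !mulmxA [_ *m invmx Q *m Q](mulmxKV uQ).
by rewrite [RHS]mxtrace_mulC !mulmxA.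
Qed.

(** First-order optimality along [H]: if the trace were positive, a short step along [H] would stay
    positive definite and increase the determinant. *)
Lemma maxdet_trace_le0 P U H : (0 < N)%N -> U \in unitmx -> P = U^T *m U ->
  H^T = H ->
  (forall s, pd (P + s *: H) -> ln (\det (P + s *: H)) <= ln (\det P)) ->
  \tr (invmx P *m H) <= 0.
Proof.
move=> N0 uU PE symH maxP; rewrite leNgt; apply/negP => tr_gt0.
have uP : P \in unitmx by rewrite PE unitmx_mul unitmx_tr uU.
have symP : P^T = P by rewrite PE trmx_mul trmxK.
have [K detK] := det_1DZ_ge (invmx P *m H) N0.
pose W := (invmx U)^T *m H *m invmx U.
set tau := \tr _ in tr_gt0 detK.
(* The step is short enough for three bounds at once: [s < 1], [|s W|^2 < 1] for positive
   definiteness, and [s K < tau] so that the linear term wins. *)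
pose m := 1 + `|K| + sqfrob W + tau; pose s := Num.min 1 tau / (2 * m).
have K0 := normr_ge0 K; have KK := ler_norm K; have W0 := sqfrob_ge0 W.
have m_gt0 : 0 < m by rewrite /m; lra.
have s_gt0 : 0 < s by rewrite divr_gt0 ?mulr_gt0 // lt_min ltr01.
have sm : s * (2 * m) = Num.min 1 tau by rewrite divfK // gt_eqF // mulr_gt0.
have sm1 : s * (2 * m) <= 1 by rewrite sm ge_min lexx.
have smt : s * (2 * m) <= tau by rewrite sm ge_min lexx orbT.
have s1 : s < 1 by rewrite /m in sm1; nra.
have detP : 0 < \det P.
  by rewrite PE det_mulmx det_tr -expr2 exprn_even_gt0 //= -unitfE -unitmxE.
have : ln (\det (P + s *: H)) <= ln (\det P).
  apply: maxP; split; first by rewrite /symmx linearD linearZ /= symP symH.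
  move=> x x0; have -> : P + s *: H = U^T *m (1%:M + s *: W) *m U.
    rewrite mulmxDr mulmxDl mulmx1 -PE -scalemxAr -scalemxAl /W trmx_inv.
    by rewrite !mulmxA mulmxV ?unitmx_tr // mul1mx mulmxKV.
  have -> : x^T *m (U^T *m (1%:M + s *: W) *m U) *m x =
    (U *m x)^T *m (1%:M + s *: W) *m (U *m x) by rewrite trmx_mul !mulmxA.
  apply: quad_form_1D_gt0.
    rewrite sqfrobZ /m in sm1 *; nra.
  by apply: contra x0 => /eqP Ux; rewrite -[x](mulKmx uU) Ux mulmx0.
have -> : \det (P + s *: H) = \det P * \det (1%:M + s *: (invmx P *m H)).
  by rewrite -det_mulmx mulmxDr mulmx1 -scalemxAr mulKVmx.
have d1 : 1 < \det (1%:M + s *: (invmx P *m H)).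
  apply: lt_le_trans (detK s _); last by rewrite s_gt0 ltW.
  have sK : s * K < tau.
    have : s * K <= s * `|K| by rewrite ler_pM2l.
    have : 0 <= s * `|K| by rewrite mulr_ge0 // ltW.
    have : 0 <= s * sqfrob W by rewrite mulr_ge0 // ltW.
    have : 0 < s * tau by rewrite mulr_gt0.
    rewrite /m in smt; lra.
  have : 0 < s * (tau - s * K) by rewrite mulr_gt0 // subr_gt0.
  lra.
rewrite ler_ln ?posrE ?mulr_gt0 //; last exact: lt_trans d1.
by rewrite -[leRHS]mulr1 ler_pM2l // leNgt d1.
Qed.

Lemma cholesky_factor_unitmx P U : cholesky_factor P U -> U \in unitmx.
Proof.
move=> [trigU [diagU _]]; rewrite -unitmx_tr unitmxE det_trig; last first.
  by apply/is_trig_mxP => i j ij; rewrite mxE trigU.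
rewrite unitfE gt_eqF //; apply: prodr_gt0 => i _; by rewrite mxE.
Qed.

End PositiveDefinite.

(** * Optimality conditions, central-path parameters and weak duality *)

Section Sdp.
Set Implicit Arguments. Unset Strict Implicit. Unset Printing Implicit Defensive.
Context {R : realType} {N M : nat}.
Context (C : 'M[R]_N) (A : 'I_M -> 'M[R]_N) (b : 'I_M -> R).
Implicit Types (P Q X U H V : 'M[R]_N) (g h : 'I_M -> R).

Lemma tripC X Q : trip X Q = trip Q X.
Proof. by rewrite /trip -mxtrace_tr trmx_mul trmxK. Qed.

Lemma tripDr X P Q : trip X (P + Q) = trip X P + trip X Q.
Proof. by rewrite /trip mulmxDr linearD. Qed.

Lemma tripZr X a P : trip X (a *: P) = a * trip X P.
Proof. by rewrite /trip -scalemxAr linearZ. Qed.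

Lemma tripBr X P Q : trip X (P - Q) = trip X P - trip X Q.
Proof. by rewrite -scaleN1r tripDr tripZr mulN1r. Qed.

Lemma trip_sumr X g (F : 'I_M -> 'M[R]_N) :
  trip X (\sum_i g i *: F i) = \sum_i g i * trip X (F i).
Proof.
rewrite /trip mulmx_sumr raddf_sum; apply: eq_bigr => i _.
by rewrite -scalemxAr; exact: mxtraceZ.
Qed.

Lemma frob1_trip X : frob X = 1 -> trip X X = 1.
Proof.
by move=> X1; rewrite -[LHS]sqr_sqrtr ?sqfrob_ge0 // -/(frob X) X1 expr1n.
Qed.

(** The coefficient [a] on [C] makes this the general element of the span of [C] and the [A i]. The
    inverse of [X_t] has this form with [a = t] and [g = t gamma]. *)
Definition dual_slack a g : 'M[R]_N := a *: C - \sum_i g i *: A i.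

Hypothesis symC : symmx C.
Hypothesis symA : forall i, symmx (A i).
Hypothesis orthA : forall i j, i != j -> trip (A i) (A j) = 0.
Hypothesis orthAC : forall i, trip (A i) C = 0.
Hypothesis normC : frob C = 1.
Hypothesis normA : forall i, frob (A i) = 1.

(** In dimension 1 the unit-norm [C] and [A i] would be nonzero scalars, which cannot be orthogonal;
    in dimension 0 no matrix has norm 1. *)
Lemma sdp_dim_gt1 : (0 < M)%N -> (1 < N)%N.
Proof.
move=> M0; rewrite ltnNge; apply/negP => N1.
have := orthAC (Ordinal M0); have := frob1_trip (normA (Ordinal M0)).
have := frob1_trip normC; rewrite /trip !mxtrace_trmulE.
move: (A _) N1; move: C; case: N => [|[|//]] C' A' _.
  by rewrite big_ord0 => /eqP; rewrite eq_sym oner_eq0.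
rewrite !big_ord1 => C1 A1 /eqP; rewrite mulf_eq0 => /orP[] /eqP Z.
  by move/eqP: A1; rewrite Z mulr0 eq_sym oner_eq0.
by move/eqP: C1; rewrite Z mulr0 eq_sym oner_eq0.
Qed.

Lemma symmx_dual_slack a g : symmx (dual_slack a g).
Proof.
rewrite /symmx /dual_slack linearB linearZ /= symC raddf_sum /=.
by congr (_ - _); apply: eq_bigr => i _; rewrite linearZ /= symA.
Qed.

Lemma trip_sum_dual i g : trip (A i) (\sum_j g j *: A j) = g i.
Proof.
rewrite trip_sumr (bigD1 i) //= frob1_trip // mulr1 big1 ?addr0 // => j ji.
by rewrite orthA ?mulr0 // eq_sym.
Qed.

Lemma trip_dual_slackA i a g : trip (A i) (dual_slack a g) = - g i.
Proof. by rewrite tripBr tripZr orthAC mulr0 sub0r trip_sum_dual. Qed.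

Lemma trip_dual_slackC a g : trip C (dual_slack a g) = a.
Proof.
rewrite tripBr tripZr frob1_trip // mulr1 trip_sumr big1 ?subr0 // => i _.
by rewrite tripC orthAC mulr0.
Qed.

Lemma trip_dual_slack a g X :
  trip X (dual_slack a g) = a * trip C X - \sum_i g i * trip (A i) X.
Proof.
rewrite tripBr tripZr trip_sumr tripC; congr (_ - _).
by apply: eq_bigr => i _; rewrite tripC.
Qed.

(** Pythagoras for the orthonormal family formed by [C] and the [A i]. *)
Lemma sqfrob_dual_slack a g : sqfrob (dual_slack a g) = a ^+ 2 + \sum_i g i ^+ 2.
Proof.
rewrite -[LHS]/(trip _ _) trip_dual_slack trip_dual_slackC -expr2; congr (_ + _).
by rewrite -sumrN; apply: eq_bigr => i _; rewrite trip_dual_slackA mulrN opprK expr2.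
Qed.

Lemma tr_dual_slack a g P Q : feasible A b P -> feasible A b Q ->
  \tr (dual_slack a g *m (P - Q)) = a * (trip C P - trip C Q).
Proof.
move=> fP fQ; rewrite -{1}symmx_dual_slack -/(trip _ _) tripC trip_dual_slack tripBr.
by rewrite big1 ?subr0 // => i _; rewrite tripBr fP fQ subrr mulr0.
Qed.

Lemma maxdet_kkt P U : (0 < N)%N -> U \in unitmx -> P = U^T *m U ->
  feasible A b P ->
  (forall X, pd X -> feasible A b X -> trip C X = trip C P ->
    ln (\det X) <= ln (\det P)) ->
  exists a g, invmx P = dual_slack a g.
Proof.
move=> N0 uU PE fP maxP; set G := invmx P.
have symP : P^T = P by rewrite PE trmx_mul trmxK.
have symG : G^T = G by rewrite /G trmx_inv symP.
(* These are the coefficients of the orthogonal projection of [G] on the span of [C] and the [A i].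
   The residual [H] is a direction preserving feasibility and objective, so optimality gives
   [\tr (G *m H) <= 0], while this trace equals [|H|^2]. *)
pose a := trip C G; pose g i := - trip (A i) G.
pose H := G - dual_slack a g; exists a, g.
have CH : trip C H = 0 by rewrite tripBr trip_dual_slackC subrr.
have AH i : trip (A i) H = 0 by rewrite tripBr trip_dual_slackA opprK subrr.
apply/subr0_eq/sqfrob_eq0/eqP; rewrite eq_le sqfrob_ge0 andbT -/H.
have -> : sqfrob H = \tr (G *m H).
  rewrite -[LHS]/(trip H (G - _)) tripBr trip_dual_slack CH mulr0 big1.
    by rewrite !subr0 tripC /trip symG.
  by move=> i _; rewrite AH mulr0.
apply: (maxdet_trace_le0 N0 uU PE) => [|s pdX].
  by rewrite linearB /= symG symmx_dual_slack.
apply: maxP => // [i|]; first by rewrite tripDr tripZr AH mulr0 addr0.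
by rewrite tripDr tripZr CH mulr0 addr0.
Qed.

(** The trace of [(P^-1 - Q^-1) (P - Q)] is [(a - t)] times the difference of objectives. If [a < t]
    it is nonnegative, so [P = Q], and pairing the common inverse with [C] gives [a = t]. *)
Lemma central_param_le P U Q a g t h : U \in unitmx -> P = U^T *m U ->
  pd Q -> feasible A b P -> feasible A b Q ->
  invmx P = dual_slack a g -> invmx Q = dual_slack t h ->
  trip C P <= trip C Q -> t <= a.
Proof.
move=> uU PE pdQ fP fQ PI QI PQ; rewrite leNgt; apply/negP => at_.
suff E : P = Q.
  by move: at_; rewrite -(trip_dual_slackC a g) -(trip_dual_slackC t h) -PI -QI E ltxx.
apply: (trace_inv_sub_ge0 uU) => //.
rewrite PI QI mulmxBl linearB /= !tr_dual_slack //; nra.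
Qed.

Lemma central_param_inj P U Q a g h : U \in unitmx -> P = U^T *m U ->
  pd Q -> feasible A b P -> feasible A b Q ->
  invmx P = dual_slack a g -> invmx Q = dual_slack a h -> P = Q.
Proof.
move=> uU PE pdQ fP fQ PI QI; apply: (trace_inv_sub_ge0 uU) => //.
by rewrite PI QI mulmxBl linearB /= !tr_dual_slack // subrr.
Qed.

(** Pairing [P^-1] with [X - P] gives both [a (trip C X - trip C P)] and [\tr (P^-1 X) - N], and the
    latter is at least [- N]. *)
Lemma duality_gap P U X a g : U \in unitmx -> P = U^T *m U -> 0 < a ->
  feasible A b P -> invmx P = dual_slack a g -> psd X -> feasible A b X ->
  trip C P - N%:R / a <= trip C X.
Proof.
move=> uU PE a0 fP PI psdX fX.
have uP : P \in unitmx by rewrite PE unitmx_mul unitmx_tr uU.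
have := tr_dual_slack a g fX fP; rewrite -PI mulmxBr mulVmx // linearB /= mxtrace1.
have : 0 <= \tr (invmx P *m X).
  by rewrite PE invmx_gram // -mulmxA mxtrace_mulC psd_trace_congr_ge0.
move=> tr0 E; have : - N%:R <= a * (trip C X - trip C P) by lra.
rewrite mulrC -ler_pdivrMr // mulNr; lra.
Qed.

End Sdp.

(** * Decrease per iteration and the iteration count *)

Lemma cone_1B (R : realType) (N : nat) (useSDD : bool) (Phi : R) (V : 'M[R]_N) :
  (1 < N)%N -> Phi <= (if useSDD then 1 else 2 / N.+1%:R) ->
  V^T = V -> sqfrob V < Phi ->
  if useSDD then SDD (1%:M - V) else DD (1%:M - V).
Proof.
case: useSDD => N1 hPhi symV VPhi; first exact: (SDD_1B symV (lt_le_trans VPhi hPhi)).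
by apply: DD_1B => //; apply/ltW/(lt_le_trans VPhi).
Qed.

(** Passes to the limit [s = r], because cone membership is obtained only for steps strictly below
    the critical length. *)
Lemma le_sub_of_lt (R : realFieldType) (x y r : R) : 0 < r ->
  (forall s, 0 <= s < r -> x <= y - s) -> x <= y - r.
Proof.
move=> r0 H; have := H 0; rewrite lexx r0 subr0 => /(_ isT) xy.
rewrite leNgt; apply/negP => yr.
have : x <= y - (y - x + r) / 2 by apply: H; apply/andP; split; lra.
lra.
Qed.

Theorem theorem4p12 (R : realType) (N M : nat)
  (C : 'M[R]_N) (A : 'I_M -> 'M[R]_N) (b : 'I_M -> R)
  (* problem data *)
  (HM : (0 < M)%N)
  (HCsym : symmx C) (HAsym : forall i, symmx (A i))
  (HAorth : forall i j, i != j -> trip (A i) (A j) = 0)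
  (HAC : forall i, trip (A i) C = 0)
  (HCn : frob C = 1) (HAn : forall i, frob (A i) = 1)
  (Hslater : exists X, pd X /\ feasible A b X)
  (Hbdd : has_lbound [set trip C X | X in [set X | psd X /\ feasible A b X]])
  (* p^* *)
  (pstar : R)
  (Hpstar : pstar = inf [set trip C X | X in [set X | psd X /\ feasible A b X]])
  (* central path X_t and Lagrange multipliers gamma(t) *)
  (Xc : R -> 'M[R]_N) (gamma : R -> 'I_M -> R)
  (HXc : forall t, 0 < t ->
     [/\ pd (Xc t), feasible A b (Xc t),
         forall X, pd X -> feasible A b X ->
           trip C (Xc t) - t^-1 * ln (\det (Xc t)) <= trip C X - t^-1 * ln (\det X)
       & invmx (Xc t) = t *: (C - \sum_i gamma t i *: A i)])
  (* the cone K and Phi *)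
  (useSDD : bool) (Phi : R)
  (HPhi : 0 < Phi <= (if useSDD then 1 else 2 / (N.+1)%:R))
  (t0 epsstar : R) (Ht0 : 0 < t0)
  (Heps : 0 < epsstar <= N%:R / t0)
  (Theta : R)
  (HTheta : (exists2 t, t0 <= t <= N%:R / epsstar &
                Theta = \sum_i (gamma t i) ^+ 2) /\
            (forall t, t0 <= t <= N%:R / epsstar ->
                \sum_i (gamma t i) ^+ 2 <= Theta))
  (* the idealized algorithm *)
  (Xs Xdec U : nat -> 'M[R]_N)
  (HX0 : Xs 0%N = Xc t0)
  (HU : forall k, cholesky_factor (Xs k) (U k))
  (Hdec : forall k,
     (feasible A b (Xdec k.+1) /\
      exists2 Y, (if useSDD then SDD Y else DD Y) &
                 Xdec k.+1 = (U k)^T *m Y *m U k) /\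
     (forall X Y, feasible A b X -> (if useSDD then SDD Y else DD Y) ->
                  X = (U k)^T *m Y *m U k -> trip C (Xdec k.+1) <= trip C X))
  (Hcent : forall k,
     [/\ pd (Xs k.+1), feasible A b (Xs k.+1),
         trip C (Xs k.+1) = trip C (Xdec k.+1)
       & forall X, pd X -> feasible A b X -> trip C X = trip C (Xdec k.+1) ->
           ln (\det X) <= ln (\det (Xs k.+1))]) :
  let chi := N%:R * Num.sqrt (1 + Theta) /
             (N%:R * Num.sqrt (1 + Theta) - Num.sqrt Phi) in
  let kappa := `|Num.ceil ((ln (N%:R / epsstar) - ln t0) / ln chi)|%N in
  1 < chi /\ trip C (Xs kappa) - pstar <= epsstar.
Proof.
move=> chi kappa; have N1 := sdp_dim_gt1 HAC HCn HAn HM.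
have N0 : (0 < N)%N := ltnW N1.
case/andP: HPhi => Phi0 hPhi; case/andP: Heps => eps0 epsN.
have n0 : 0 < N%:R :> R by rewrite ltr0n.
have Phi1 : Phi <= 1.
  apply: le_trans hPhi _; case: (useSDD) => //.
  by rewrite ler_pdivrMr ?ltr0n // mul1r ler_nat ltnS.
have Theta0 : 0 <= Theta.
  by have [[t _ ->] _] := HTheta; apply: sumr_ge0 => i _; exact: sqr_ge0.
pose r := Num.sqrt (1 + Theta).
have chiE : chi = N%:R * r / (N%:R * r - Num.sqrt Phi) by [].
have r1 : 1 <= r by rewrite -sqrtr1 ler_wsqrtr // lerDl.
have r2 : r ^+ 2 = 1 + Theta by rewrite sqr_sqrtr // addr_ge0.
have p0 : 0 < Num.sqrt Phi by rewrite sqrtr_gt0.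
have p1 : Num.sqrt Phi <= 1 by rewrite -sqrtr1 ler_wsqrtr.
have p2 : Num.sqrt Phi ^+ 2 = Phi by rewrite sqr_sqrtr // ltW.
have Nr : 2 <= N%:R * r.
  have N2 : 2 <= N%:R :> R by rewrite ler_nat.
  nra.
have den0 : 0 < N%:R * r - Num.sqrt Phi by lra.
have chi1 : 1 < chi by rewrite chiE ltr_pdivlMr // mul1r; lra.
have chiV : chi^-1 = 1 - Num.sqrt Phi / (N%:R * r).
  by rewrite chiE invf_div mulrBl divff // gt_eqF //; lra.
split=> //.
have uU k : U k \in unitmx := cholesky_factor_unitmx (HU k).
have XE k : Xs k = (U k)^T *m U k by have [_ []] := HU k.
have XcI t : 0 < t -> invmx (Xc t) = dual_slack C A t (fun i => t * gamma t i).
  move=> t_gt0; have [_ _ _ ->] := HXc t t_gt0.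
  rewrite scalerBr scaler_sumr; congr (_ - _).
  by apply: eq_bigr => i _; rewrite scalerA.
have [pd0 f0 _ _] := HXc t0 Ht0.
have feas k : feasible A b (Xs k).
  by case: k => [|k]; [rewrite HX0|have [] := Hcent k].
have step k s : 0 <= s ->
    s ^+ 2 * sqfrob (invmx (Xs k)) < Phi ->
    trip C (Xs k.+1) <= trip C (Xs k) - s.
  move=> s0 sPhi; have [_ _ -> _] := Hcent k; have [_ opt] := Hdec k.
  pose W := (invmx (U k))^T *m C *m invmx (U k).
  have -> : trip C (Xs k) - s = trip C (Xs k - s *: C).
    by rewrite tripBr tripZr (frob1_trip HCn) mulr1.
  apply: (opt _ (1%:M - s *: W)).
  - by move=> i; rewrite tripBr tripZr HAC mulr0 subr0; exact: feas.
  - apply: (@cone_1B _ _ _ Phi) => //.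
      by rewrite linearZ /= /W !trmx_mul trmxK HCsym mulmxA.
    rewrite sqfrobZ; apply: le_lt_trans sPhi; apply: ler_wpM2l; first exact: sqr_ge0.
    apply: le_trans (sqfrob_congr_le _ _) _ => //.
    by rewrite -invmx_gram // -XE -[sqfrob C]/(trip C C) (frob1_trip HCn) mulr1.
  - rewrite mulmxBr mulmxBl mulmx1 -XE -scalemxAr -scalemxAl; congr (_ - _ *: _).
    by rewrite /W trmx_inv !mulmxA mulmxV ?unitmx_tr // mul1mx mulmxKV.
(* With [s = 0] the current iterate is its own competitor, given by [Y = 1]. *)
have mono k : trip C (Xs k.+1) <= trip C (Xs k).
  by rewrite -[leRHS]subr0; apply: step => //; rewrite expr0n mul0r.
have mono0 k : trip C (Xs k) <= trip C (Xc t0).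
  by elim: k => [|k]; [rewrite HX0|exact: le_trans].
have central k : exists2 a, t0 <= a & Xs k = Xc a.
  case: k => [|k]; first by exists t0.
  have [_ _ Xdk maxX] := Hcent k.
  have [a [g XI]] : exists a g, invmx (Xs k.+1) = dual_slack C A a g.
    apply: (maxdet_kkt HCsym HAsym HAorth HAC HCn HAn N0 (uU k.+1) (XE _)
      (feas _)) => X pdX fX XC.
    by apply: maxX => //; rewrite XC.
  have ta : t0 <= a.
    exact: (central_param_le HCsym HAsym HAC HCn (uU k.+1) (XE _) pd0 (feas _) f0
      XI (XcI _ Ht0)).
  have a0 := lt_le_trans Ht0 ta; have [pda fa _ _] := HXc a a0.
  exists a => //.
  exact: (central_param_inj HCsym HAsym (uU k.+1) (XE _) pda (feas _) fa
    XI (XcI _ a0)).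
have gap k a : t0 <= a -> Xs k = Xc a -> trip C (Xs k) - pstar <= N%:R / a.
  move=> ta Xa; have a0 := lt_le_trans Ht0 ta.
  rewrite lerBlDr -lerBlDl Hpstar; apply: lb_le_inf.
    have [X [pdX fX]] := Hslater; exists (trip C X), X => //.
    by split=> //; exact: pd_psd.
  move=> _ [X [psdX fX] <-].
  apply: (duality_gap HCsym HAsym (uU k) (XE k) a0 (feas k) _ psdX fX).
  by rewrite Xa XcI.
(* The disjunction is needed because [Theta] bounds the multipliers only up to [N / epsstar]. Past
   that parameter the gap is already at most [epsstar], and [mono] keeps it there. *)
have contr k : trip C (Xs k) - pstar <= epsstar \/
    trip C (Xs k) - pstar <= N%:R / t0 / chi ^+ k.
  elim: k => [|k [IH|IH]]; first by right; rewrite expr0 divr1; apply: gap.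
    by left; have := mono k; lra.
  have [a ta Xa] := central k; have a0 := lt_le_trans Ht0 ta.
  have gapa := gap k a ta Xa.
  have [aN|aN] := leP a (N%:R / epsstar); last first.
    left; have : N%:R / a <= epsstar.
      by rewrite ler_pdivrMr // mulrC -ler_pdivrMr // ltW.
    by have := mono k; lra.
  right; have dec : trip C (Xs k.+1) <= trip C (Xs k) - Num.sqrt Phi / (a * r).
    have ar0 : 0 < a * r by rewrite mulr_gt0 //; lra.
    apply: le_sub_of_lt => [|s /andP[s0 sr]]; first by rewrite divr_gt0.
    apply: step => //; rewrite -p2 Xa XcI // sqfrob_dual_slack //.
    apply: le_lt_trans (_ : (s * (a * r)) ^+ 2 < _).
      rewrite exprMn; apply: ler_wpM2l; first exact: sqr_ge0.
      rewrite exprMn r2 mulrDr mulr1 lerD2l.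
      under eq_bigr do rewrite exprMn.
      rewrite -mulr_sumr; apply: ler_wpM2l; first exact: sqr_ge0.
      by apply: HTheta.2; rewrite ta.
    have : s * (a * r) < Num.sqrt Phi by rewrite -ltr_pdivlMr.
    have : 0 <= s * (a * r) by rewrite mulr_ge0 // ltW.
    nra.
  have -> : N%:R / t0 / chi ^+ k.+1 = chi^-1 * (N%:R / t0 / chi ^+ k).
    by rewrite exprS invfM; ring.
  apply: le_trans (_ : chi^-1 * (trip C (Xs k) - pstar) <= _); last first.
    by apply: ler_wpM2l => //; rewrite invr_ge0; lra.
  have q0 : 0 <= Num.sqrt Phi / (N%:R * r) by rewrite divr_ge0 ?ltW //; lra.
  (* The guaranteed decrease is the fraction [1 - chi^-1] of [N / a], and [N / a] dominates the
     gap. *)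
  have E : Num.sqrt Phi / (a * r) = Num.sqrt Phi / (N%:R * r) * (N%:R / a).
    by field; rewrite !gt_eqF //; lra.
  have := ler_wpM2l q0 gapa; rewrite -E chiV mulrBl mul1r; lra.
have [//|/le_trans] := contr kappa; apply.
have lnchi : 0 < ln chi by apply: ln_gt0.
have chi0 : 0 < chi by lra.
(* The absolute value turns the integer ceiling into a natural number and never lowers it. *)
have kx : (ln (N%:R / epsstar) - ln t0) / ln chi <= kappa%:R.
  apply: le_trans (ceil_ge _) _; rewrite -[kappa%:R]/((Posz kappa)%:~R) ler_int.
  by rewrite /kappa abszE ler_norm.
have : ln (N%:R / epsstar / t0) <= ln (chi ^+ kappa).
  by rewrite lnXn // -[_ *+ kappa]mulr_natl -ler_pdivrMr // ln_div ?posrE ?divr_gt0.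
rewrite ler_ln ?posrE ?divr_gt0 ?exprn_gt0 // => h.
by rewrite ler_pdivrMr ?exprn_gt0 // -ler_pdivrMl // mulrC mulrAC.
Qed.
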